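(* Let $n\geqslant4$ and let $(\alpha,\beta)$ be either $(0,1)$ or $(1,\beta)$ with $\beta\in\mathbb{C}$, $(\alpha,\beta)\neq(1,2-n)$. Let $\mathfrak{s}_{1,n+1}^{\alpha\beta}$ be the $(n+1)$-dimensional complex Lie algebra with basis $e_1,\ldots,e_{n+1}$ and non-zero commutation relations \[ [e_k,e_n]=e_{k-1},\ k=2,\ldots,n-1,\qquad [e_k,e_{n+1}]=\gamma_ke_k,\ k=1,\ldots,n-1,\qquad [e_n,e_{n+1}]=\alpha e_n, \] where $\gamma_k=(n-k-1)\alpha+\beta$. Put $\xi_1=e_1$ and $\xi_k=\sum_{j=1}^k\frac{(-1)^{k-j}}{(k-j)!}e_1^{j-2}e_2^{k-j}e_j$ for $k=3,\ldots,n-1$. Then a complete set of generalized Casimir operators of $\mathfrak{s}_{1,n+1}^{\alpha\beta}$ (a basis of $\mathrm{Inv}(\mathfrak{s}_{1,n+1}^{\alpha\beta})$) is formed by the $n-3$ expressions \[ \xi_1^{-(k-1)\frac{(n-3)\alpha+\beta}{(n-2)\alpha+\beta}}\,\xi_k,\qquad k=3,\ldots,n-1. \]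
   Context: For a finite-dimensional complex Lie algebra $\mathfrak{g}$ with basis $e_1,\ldots,e_N$, $[e_i,e_j]=c_{ij}^ke_k$, let $x_1,\ldots,x_N$ be the coordinates on $\mathfrak{g}^*$ associated with the dual basis. An invariant of the coadjoint action is a (possibly only locally defined, on a connected open set) analytic function $F(x_1,\ldots,x_N)$ invariant under the coadjoint action, equivalently $\sum_{j,k}c_{ij}^kx_k\,\partial F/\partial x_j=0$ for all $i$. The maximal number of functionally independent invariants is $N_\mathfrak{g}=\dim\mathfrak{g}-\sup_x\operatorname{rank}(\sum_k c_{ij}^kx_k)_{i,j}$. A basis (complete set) of invariants is a set of $N_\mathfrak{g}$ functionally independent invariants (every invariant is then locally a function of them). Elements of $\mathrm{Inv}(\mathfrak{g})$ (generalized Casimir operators) are obtained from invariants by replacing $x_i$ by $e_i$ (with symmetrization of non-commuting products); here only the mutually commuting elements $e_1,\ldots,e_{n-1}$ occur, so $e_i$ may simply be read as the coordinate $x_i$. Complex powers are understood as local branches. *)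

(* Defs.v *)
From HB Require Import structures.
From mathcomp Require Import all_boot all_order all_algebra.
From mathcomp Require Import complex.
From mathcomp Require Import all_classical all_reals all_analysis.

Set Implicit Arguments.
Unset Strict Implicit.
Unset Printing Implicit Defensive.

Import Order.TTheory GRing.Theory Num.Theory.
Import numFieldNormedType.Exports.

Local Open Scope classical_set_scope.
Local Open Scope ring_scope.

(* R[i] seen through its numClosedFieldType structure: the topology and the   *)
(* normed module structure on a numeric field are attached to the carrier of  *)
(* the abstract structure, not to the type constructor R[i].                  *)
Definition Cx (R : realType) : numClosedFieldType := R[i].

Definition cexp (R : realType) (z : Cx R) : Cx R :=
  ((expR (complex.Re z) * cos (complex.Im z))
    +i* (expR (complex.Re z) * sin (complex.Im z)))%C.

Record lieAlgType (K : fieldType) := LieAlgType {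
  lie_vect :> vectType K;
  lie : lie_vect -> lie_vect -> lie_vect;
  lie_linearl : forall (a : K) (x y z : lie_vect),
    lie (a *: x + y) z = a *: lie x z + lie y z;
  lie_linearr : forall (a : K) (x y z : lie_vect),
    lie z (a *: x + y) = a *: lie z x + lie z y;
  lie_alt : forall x : lie_vect, lie x x = 0;
  lie_jacobi : forall x y z : lie_vect,
    lie x (lie y z) + lie y (lie z x) + lie z (lie x y) = 0 }.

Section Invariants.
Variables (R : realType) (g : lieAlgType (Cx R)) (N : nat) (e : N.-tuple g).

Definition structure_const (i j k : 'I_N) : Cx R := coord e k (lie e`_i e`_j).

(* A row vector x lists the coordinates x_k = <x, e_k> of a point of g^*. *)
Definition coadj_mx (x : 'rV[Cx R]_N) : 'M[Cx R]_N :=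
  \matrix_(i, j) \sum_k structure_const i j k * x 0 k.

Definition num_invariants : nat :=
  (\dim {:g}
    - \max_(r < N.+1 | `[< exists x, \rank (coadj_mx x) = r >]) r)%N.

(* Analytic functions of several complex variables: complex (Frechet)         *)
(* differentiability at every point of U, which is meant to be open.          *)
Definition analytic_on (m : nat) (U : set 'rV[Cx R]_m)
    (F : 'rV[Cx R]_m -> Cx R) : Prop :=
  forall x, U x -> differentiable F x.

Definition domain_set (m : nat) (U : set 'rV[Cx R]_m) : Prop :=
  [/\ open U, U !=set0 & connected U].

Definition invariant_on (U : set 'rV[Cx R]_N) (F : 'rV[Cx R]_N -> Cx R) : Prop :=
  analytic_on U F /\
  forall x, U x -> forall i : 'I_N,
    \sum_j coadj_mx x i j * 'D_(delta_mx 0 j) F x = 0.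

(* An analytic relation Phi(F_1, ..., F_m) = 0 on V, where Phi vanishes       *)
(* identically on no nonempty open subset of its domain of definition.        *)
Definition functionally_dependent (m : nat) (V : set 'rV[Cx R]_N)
    (F : 'I_m -> 'rV[Cx R]_N -> Cx R) : Prop :=
  exists (W : set 'rV[Cx R]_m) (Phi : 'rV[Cx R]_m -> Cx R),
    [/\ open W,
        analytic_on W Phi,
        (forall x, V x -> W (\row_i F i x) /\ Phi (\row_i F i x) = 0)
      & forall W' : set 'rV[Cx R]_m, open W' -> W' !=set0 -> W' `<=` W ->
          exists2 y, W' y & Phi y != 0].

Definition functionally_independent (m : nat) (U : set 'rV[Cx R]_N)
    (F : 'I_m -> 'rV[Cx R]_N -> Cx R) : Prop :=
  forall V : set 'rV[Cx R]_N, open V -> V !=set0 -> V `<=` U ->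
    ~ functionally_dependent V F.

Definition invariant_basis (m : nat) (U : set 'rV[Cx R]_N)
    (F : 'I_m -> 'rV[Cx R]_N -> Cx R) : Prop :=
  [/\ forall i, invariant_on U (F i),
      functionally_independent U F
    & m = num_invariants].

(* p is a branch of the complex power f ^ a on U: p = exp (a log f) for some  *)
(* continuous branch l of log f; in particular f does not vanish on U.        *)
Definition power_branch (U : set 'rV[Cx R]_N) (f : 'rV[Cx R]_N -> Cx R)
    (a : Cx R) (p : 'rV[Cx R]_N -> Cx R) : Prop :=
  exists l : 'rV[Cx R]_N -> Cx R,
    forall x, U x ->
      [/\ {for x, continuous l}, cexp (l x) = f x & p x = cexp (a * l x)].

End Invariants.

(* In what follows e_k and x_k are numbered from k = 1 to n + 1. *)
Section Solvable.
Variables (R : realType) (n : nat) (alpha beta : Cx R).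

Definition gam (k : nat) : Cx R := (n - k - 1)%N%:R * alpha + beta.

(* The remaining brackets of basis elements follow by antisymmetry. *)
Definition commutation_relations (g : lieAlgType (Cx R)) (e : n.+1.-tuple g) :
    Prop :=
  let E (k : nat) : g := e`_k.-1 in
  [/\ forall k l, (1 <= k <= n - 1)%N -> (1 <= l <= n - 1)%N ->
        lie (E k) (E l) = 0,
      lie (E 1%N) (E n) = 0,
      forall k, (2 <= k <= n - 1)%N -> lie (E k) (E n) = E k.-1,
      forall k, (1 <= k <= n - 1)%N -> lie (E k) (E n.+1) = gam k *: E k
    & lie (E n) (E n.+1) = alpha *: E n].

Definition xcoord (k : nat) (x : 'rV[Cx R]_n.+1) : Cx R := x 0 (inord k.-1).

(* For j = 1 the exponent j - 2 of x_1 is -1. *)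
Definition xi (k : nat) (x : 'rV[Cx R]_n.+1) : Cx R :=
  if k == 1%N then xcoord 1 x else
  \sum_(1 <= j < k.+1)
    (-1) ^+ (k - j) / ((k - j)`!)%:R *
    (xcoord 1 x ^ (j%:Z - 2) * xcoord 2 x ^+ (k - j) * xcoord j x).

Definition xi_exponent (k : nat) : Cx R :=
  - (k - 1)%N%:R * (((n - 3)%N%:R * alpha + beta) / ((n - 2)%N%:R * alpha + beta)).

End Solvable.

(* Main.v *)
Require Import Defs.
From HB Require Import structures.
From mathcomp Require Import all_boot all_order all_algebra.
From mathcomp Require Import complex.
From mathcomp Require Import all_classical all_reals all_analysis.
From mathcomp Require Import ring lra zify.

Import Order.TTheory GRing.Theory Num.Theory.
Import numFieldNormedType.Exports.

Local Open Scope classical_set_scope.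
Local Open Scope ring_scope.

Set Implicit Arguments.
Unset Strict Implicit.
Unset Printing Implicit Defensive.

(** On a point [x] of the dual, the bracket relations say that the invariants
    are the functions of [x_1, ..., x_(n-1)] annihilated by the two vector
    fields [x_(j-1) d/dx_j] and [gamma_j x_j d/dx_j] (summed over [j]). The
    first kills [xi_k] because the derivative telescopes; for the second
    [xi_k] is homogeneous of weight [(k-1) gamma_2] while [x_1] has weight
    [gamma_1], so [xi_1 ^ (-(k-1) gamma_2 / gamma_1) xi_k] has weight 0.
    The coadjoint matrix has an [(n-1) x (n-1)] zero block, hence rank at most
    4, with equality at the point [x_1 = 1], [x_j = 0] for [j > 1]; there are
    therefore [n - 3] independent invariants. With [x_1], [x_2] frozen, the
    branches of [log x_1] are locally constant and the candidates become an
    invertible triangular affine function of [x_3, ..., x_(n-1)]: their joint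
    image has nonempty interior, which excludes any analytic relation. *)

(** * The complex exponential near the origin *)

Lemma is_derive0_approx (R : realType) (f : R -> R) (d : R) :
  is_derive (0 : R) (1 : R) f d -> forall eps : R, 0 < eps ->
  exists2 delta : R, 0 < delta & forall h, `|h| < delta -> `|f h - f 0 - d * h| <= eps * `|h|.
Proof.
move=> [df dfE] eps eps0; have /derivable_nbhs/eqaddoP/(_ eps eps0) := df.
rewrite dfE => /nbhs_ballP[delta /= delta0 fE]; exists delta => // h hdelta.
have := fE h; rewrite -ball_normE /= sub0r normrN => /(_ hdelta).
rewrite [X in `|X|](_ : _ = f (h * 1 + 0) - (f 0 + h * d)) //.
by rewrite mulr1 addr0 opprD addrA (mulrC h).
Qed.

Section ComplexExponential.
Variable R : realType.
Implicit Types (w z : Cx R).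

Lemma cexpD w z : cexp (w + z) = cexp w * cexp z.
Proof.
case: w z => [a b] [c d]; rewrite /cexp /= expRD cosD sinD.
by apply/eqP; rewrite eq_complex /=; apply/andP; split; apply/eqP; ring.
Qed.

Lemma cexp0 : cexp (0 : Cx R) = 1.
Proof. by rewrite /cexp /= expR0 cos0 sin0 mulr1 mulr0. Qed.

Lemma cexp_neq0 w : cexp w != 0.
Proof.
have: cexp w * cexp (- w) != 0 by rewrite -cexpD subrr cexp0 oner_eq0.
by rewrite mulf_eq0 negb_or => /andP[].
Qed.

Lemma normc_leD (a b : R) : `|(a +i* b)%C : Cx R| <= (`|a| + `|b|)%:C%C.
Proof.
have -> : (a +i* b)%C = (a%:C + 'i * b%:C)%C :> Cx R by rewrite [LHS]complexE.
apply: le_trans (ler_normD _ _) _; rewrite normrM rmorphD /=.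
rewrite ![`|_ : Cx R|]normc_def /= !expr0n /= !addr0 add0r expr1n sqrtr1 mul1r.
by rewrite !sqrtr_sqr.
Qed.

(** First-order expansions of [expR], [cos] and [sin] at 0 are multiplied out; this is the only
    analytic input about the complex exponential. *)
Lemma cexp_approx (e : Cx R) : 0 < e ->
  \forall w \near (0 : Cx R), `|cexp w - 1 - w| <= e * `|w|.
Proof.
move=> e0; have [e' e'E] : exists e' : R, e = e'%:C%C.
  by apply/complex_realP; exact: gtr0_real.
rewrite {}e'E in e0 *; rewrite ltcR in e0.
(* With [m] the modulus of the argument, the real and imaginary parts of the remainder are at most
   [(2 + 1 + 1) * eps * m] and [(4 + 1) * eps * m], hence the 9. The bound [eps <= 1] gives
   [|p + a| <= 2 * m], and [m < eps] turns [m ^+ 2] into [eps * m]. *)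
have [eps [eps0 eps1 eps9]] : exists eps : R,
    [/\ 0 < eps, eps <= 1 & 9 * eps <= e'].
  exists (Num.min 1 (e' / 9)); split.
  - by rewrite lt_min ltr01 divr_gt0.
  - by rewrite ge_min lexx.
  - by rewrite mulrC -ler_pdivlMr // ge_min lexx orbT.
have [d1 d1_0 expE] := @is_derive0_approx R _ _ (is_derive_expR 0) _ eps0.
have [d2 d2_0 cosE] := @is_derive0_approx R _ _ (is_derive_cos 0) _ eps0.
have [d3 d3_0 sinE] := @is_derive0_approx R _ _ (is_derive_sin 0) _ eps0.
pose d := Num.min eps (Num.min d1 (Num.min d2 d3)).
have d0 : 0 < d by rewrite /d !lt_min eps0 d1_0 d2_0.
apply/nbhs_ballP; exists d%:C%C => /=; first by rewrite ltcR.
move=> w; rewrite -ball_normE /= sub0r normrN => wd.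
have [m mE] : exists m : R, `|w| = m%:C%C.
  by apply/complex_realP; exact: normr_real.
case: w wd mE => a b wd mE.
have am : `|a| <= m by rewrite -lecR -mE; exact: (normc_ge_Re (a +i* b)%C).
have bm : `|b| <= m.
  rewrite -lecR -mE normc_def /= lecR -sqrtr_sqr ler_wsqrtr // lerDr.
  exact: sqr_ge0.
rewrite {}mE ltcR in wd *.
have [m_eps m1 m2 m3] : [/\ m < eps, m < d1, m < d2 & m < d3].
  by move: wd; rewrite /d !lt_min => /and4P[].
have m0 : 0 <= m by exact: le_trans (normr_ge0 a) am.
have := expE a (le_lt_trans am m1); have := cosE b (le_lt_trans bm m2).
have := sinE b (le_lt_trans bm m3).
rewrite expR0 cos0 sin0 subr0 !mul1r oppr0 mul0r subr0.
set p := expR a - 1 - a; set q := cos b - 1; set r := sin b - b => rE qE pE.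
have {}pE : `|p| <= eps * m by rewrite (le_trans pE) // ler_wpM2l // ltW.
have {}qE : `|q| <= eps * m by rewrite (le_trans qE) // ler_wpM2l // ltW.
have {}rE : `|r| <= eps * m by rewrite (le_trans rE) // ler_wpM2l // ltW.
have -> : cexp (a +i* b)%C - 1 - (a +i* b)%C =
    (((p + a) * q + p + q) +i* ((p + a) * (r + b) + r))%C :> Cx R.
  apply/eqP; rewrite eq_complex /= /p /q /r.
  by apply/andP; split; apply/eqP; ring.
apply: le_trans (normc_leD _ _) _; rewrite -rmorphM lecR /=.
have pa : `|p + a| <= 2 * m.
  by rewrite (le_trans (ler_normD _ _)) //; nra.
have rb : `|r + b| <= 2 * m.
  by rewrite (le_trans (ler_normD _ _)) //; nra.
have h1 : `|(p + a) * q| <= 2 * (eps * m).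
  rewrite normrM; have := ler_pM (normr_ge0 _) (normr_ge0 _) pa qE.
  by move/le_trans; apply; nra.
have h2 : `|(p + a) * (r + b)| <= 4 * (eps * m).
  rewrite normrM; have := ler_pM (normr_ge0 _) (normr_ge0 _) pa rb.
  by move/le_trans; apply; nra.
have h3 := ler_normD ((p + a) * q + p) q; have h4 := ler_normD ((p + a) * q) p.
have h5 := ler_normD ((p + a) * (r + b)) r.
have h6 : 9 * eps * m <= e' * m by rewrite ler_wpM2r.
lra.
Qed.

(* Junk value repaired at 0: with it, [cexp w = 1 + w * expq w] everywhere. *)
Definition expq w : Cx R := if w == 0 then 1 else (cexp w - 1) / w.

Lemma cexp_expq w : cexp w = 1 + w * expq w.
Proof.
rewrite /expq; case: eqVneq => [->|w0]; first by rewrite cexp0 mul0r addr0.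
by rewrite mulrC divfK // subrKC.
Qed.

Lemma cvg_expq : expq w @[w --> (0 : Cx R)] --> (1 : Cx R).
Proof.
apply/(@cvgrPdist_le (Cx R) (Cx R) _ _ (nbhs_filter (0 : Cx R))) => e e0.
apply: filterS (cexp_approx e0) => w we.
rewrite /expq; case: eqVneq => [_|w0]; first by rewrite subrr normr0 ltW.
have -> : 1 - (cexp w - 1) / w = - ((cexp w - 1 - w) / w) by field.
by rewrite normrN normrM normfV ler_pdivrMr ?normr_gt0.
Qed.

End ComplexExponential.

(** * Branches of complex powers *)

(** Carathéodory's criterion: the error [u (y - x) * (H y - H x)] is negligible because [u] is
    Lipschitz and [H] is continuous at [x]. *)
Lemma is_diff_caratheodory (K : numFieldType) (V : normedModType K)
    (u : {linear V -> K}) (f H : V -> K) (x : V) :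
  continuous u -> {for x, continuous H} ->
  (\forall y \near x, f y = f x + u (y - x) * H y) ->
  is_diff x f (H x \*: u).
Proof.
move=> cu cH fE.
have cHu : continuous (H x \*: u).
  by move=> y; apply: continuousZl_tmp; exact: cu.
have fo : f \o shift x = cst (f x) + (H x \*: u) +o_ 0 id.
  have [k k0 uk] := linear_lipschitz cu.
  apply/eqaddoP => e e0.
  have ek0 : 0 < e / k by rewrite divr_gt0.
  have near1 : \forall y \near x,
      `|f y - (f x + H x * u (y - x))| <= e * `|y - x|.
    have /(@cvgrPdist_le K K _ _ (nbhs_filter x))/(_ _ ek0) := cH.
    apply: filterS2 fE => y -> Hy.
    rewrite opprD addrACA subrr add0r (mulrC (H x)) -mulrBr normrM.
    apply: le_trans (ler_pM (normr_ge0 _) (normr_ge0 _) (uk _) _) _.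
      by rewrite distrC; exact: Hy.
    by rewrite mulrAC mulrCA divff ?gt_eqF // mulr1.
  move: near1; rewrite (near_shift 0 x) subr0; apply: filterS => h /=.
  by rewrite addrK.
have dE : 'd f x = (H x \*: u) :> (V -> K) by exact: diff_unique.
by apply: DiffDef => //; apply/diff_locallyP; rewrite dE.
Qed.

Lemma is_diff_near (K : numFieldType) (V W : normedModType K)
    (f h dh : V -> W) (x : V) :
  (\forall y \near x, f y = h y) -> is_diff x h dh -> is_diff x f dh.
Proof.
move=> fh [hx dhE]; have [cd ho] := (diff_locallyP _ _).1 hx.
have fo : f \o shift x = cst (f x) + 'd h x +o_ 0 id.
  apply/eqaddoP => e e0; have /eqaddoP/(_ e e0) := ho.
  have := fh; rewrite (near_shift 0 x) subr0; apply: filterS2 => v /= fhv.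
  by rewrite !fctE /= fhv (nbhs_singleton fh).
have dE : 'd f x = 'd h x :> (V -> W) by exact: diff_unique.
by apply: DiffDef; [apply/diff_locallyP; rewrite dE|rewrite dE].
Qed.

Section Branches.
Variable R : realType.
Variable T : topologicalType.
Implicit Types (l f p : T -> Cx R) (x : T).

Lemma cvg_expq_branch (a : Cx R) l x : {for x, continuous l} ->
  expq (a * (l y - l x)) @[y --> x] --> (1 : Cx R).
Proof.
move=> cl.
apply: (@cvg_comp _ _ _ (fun y => a * (l y - l x)) (@expq R) _
  (nbhs (0 : Cx R))).
  rewrite -(mulr0 a) -(subrr (l x)).
  by apply: cvgM; [exact: cvg_cst|apply: cvgB; [exact: cl|exact: cvg_cst]].
exact: cvg_expq.
Qed.

Lemma near_expq_neq0 l x : {for x, continuous l} ->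
  \forall y \near x, expq (l y - l x) != 0.
Proof.
move=> cl; have := @cvg_expq_branch 1 l x cl.
move/cvgr_neq0/(_ (oner_neq0 _)); apply: filterS => y.
by rewrite mul1r.
Qed.

(** With [d = l y - l x], equal exponentials give [d * expq d = 0], and [expq d] tends to 1. *)
Lemma log_branch_inj l x : {for x, continuous l} ->
  \forall y \near x, cexp (l y) = cexp (l x) -> l y = l x.
Proof.
move=> cl; apply: filterS (near_expq_neq0 cl) => y q0 lyx.
have := cexp_expq (l y - l x).
rewrite cexpD lyx -cexpD subrr cexp0 => /(congr1 (fun z => z - 1)).
rewrite subrr addrAC subrr add0r => /esym/eqP.
by rewrite mulf_eq0 (negbTE q0) orbF subr_eq0 => /eqP.
Qed.

(** The branch [l] is only continuous, so the chain rule is replaced by a difference quotient of [p]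
    with respect to [f], in the form that Carathéodory's criterion takes. *)
Lemma power_branch_increment (a : Cx R) l f p x : {for x, continuous l} ->
  (\forall y \near x, cexp (l y) = f y /\ p y = cexp (a * l y)) ->
  exists H : T -> Cx R, [/\ {for x, continuous H}, H x = a * p x / f x &
    \forall y \near x, p y = p x + (f y - f x) * H y].
Proof.
move=> cl nfp; have [fx px] := nbhs_singleton nfp.
have fx0 : f x != 0 by rewrite -fx cexp_neq0.
have expq0 : expq (0 : Cx R) = 1 by rewrite /expq eqxx.
(* For [d = l y - l x], the increments are [p x * a * d * expq (a * d)] and [f x * d * expq d]; [H]
   is their quotient with [d] cancelled, so it also makes sense at [d = 0]. *)
pose H y := (a * p x / f x) * (expq (a * (l y - l x)) / expq (1 * (l y - l x))).
have Hx : H x = a * p x / f x by rewrite /H subrr !mulr0 expq0 divr1 mulr1.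
exists H; split; [|exact: Hx|].
  rewrite /prop_for /continuous_at.
  have -> : H x = a * p x / f x * (1 / 1) by rewrite Hx divr1 mulr1.
  apply: cvgM; first exact: cvg_cst.
  apply: cvgM; first exact: cvg_expq_branch.
  by apply: cvgV; [exact: oner_neq0|exact: cvg_expq_branch].
apply: filterS2 (near_expq_neq0 cl) nfp => y q0 [fy py].
rewrite /H mul1r; set d := l y - l x in q0 *.
have ly : l y = l x + d by rewrite subrKC.
have -> : f y = f x * (1 + d * expq d).
  by rewrite -fy ly cexpD fx cexp_expq.
have -> : p y = p x * (1 + a * d * expq (a * d)).
  by rewrite py ly mulrDr cexpD -px cexp_expq.
by field; rewrite fx0 q0.
Qed.

End Branches.

(** * The polynomials [xi_k] *)

Section DifferentialRules.
Variables (K : numFieldType) (V : normedModType K).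
Implicit Types f df : V -> K.

Lemma is_diff_sum m (f df : 'I_m -> V -> K) (x : V) :
  (forall i, is_diff x (f i) (df i)) ->
  is_diff x (\sum_i f i) (\sum_i df i).
Proof.
move=> fdf; elim/big_ind2: _ => [|? ? ? ? ? ?|i _]; last exact: fdf.
  exact: is_diff_cst.
exact: is_diffD.
Qed.

Lemma is_diff_exp m f df (x : V) : is_diff x f df ->
  is_diff x (f ^+ m) (m%:R * f x ^+ m.-1 *: df).
Proof.
case: m => [|m] fdf; last exact: is_diffX.
by rewrite expr0 mul0r scale0r; exact: is_diff_cst.
Qed.

End DifferentialRules.

Lemma is_diff_coord (K : numFieldType) m n (i : 'I_m) (j : 'I_n)
  (x : 'M[K]_(m, n)) :
  is_diff x (fun M : 'M[K]_(m, n) => M i j) (fun M => M i j).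
Proof.
have lin : linear (fun M : 'M[K]_(m, n) => M i j).
  by move=> a u v; rewrite !mxE.
pose coordM := GRing.isLinear.Build _ _ _ _ _ lin.
pose coordL : {linear 'M[K]_(m, n) -> K} :=
  HB.pack (fun M : 'M[K]_(m, n) => M i j) coordM.
have -> : (fun M : 'M[K]_(m, n) => M i j) = coordL by [].
have cL : continuous coordL := @coord_continuous K m n i j.
by apply: DiffDef; [exact: linear_differentiable|exact: diff_lin].
Qed.

Section XiPolynomial.
Variables (K : numFieldType) (n : nat).
Implicit Types (x v : 'rV[K]_n.+1) (k i m : nat).

Definition coordv k x : K := x 0 (inord k.-1).

Definition sgn_fact m : K := (-1) ^+ m / (m`!)%:R.

Lemma sgn_factS m : sgn_fact m.+1 * m.+1%:R = - sgn_fact m.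
Proof.
have f0 : (m`!)%:R != 0 :> K by rewrite pnatr_eq0 -lt0n fact_gt0.
have m0 : m.+1%:R != 0 :> K by rewrite pnatr_eq0.
by rewrite /sgn_fact factS natrM exprS; field; rewrite f0 addrC natr1 m0.
Qed.

(* [xi k.+2] with the pole at [x_1 = 0] of its first term cancelled *)
Definition xi_poly k x : K :=
  sgn_fact k.+1 * coordv 2 x ^+ k.+1 +
  \sum_(i < k.+1) sgn_fact (k - i) *
    (coordv 1 x ^+ i * coordv 2 x ^+ (k - i) * coordv i.+2 x).

(** The shape is the one given by the product and power rules; an exponent truncated by [.-1] at 0
    always comes with a zero factor. *)
Definition dxi_poly k x v : K :=
  sgn_fact k.+1 * (k.+1%:R * coordv 2 x ^+ k * coordv 2 v) +
  \sum_(i < k.+1) sgn_fact (k - i) *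
    (coordv 1 x ^+ i * coordv 2 x ^+ (k - i) * coordv i.+2 v +
     coordv i.+2 x *
       (coordv 1 x ^+ i *
          ((k - i)%:R * coordv 2 x ^+ (k - i).-1 * coordv 2 v) +
        coordv 2 x ^+ (k - i) * (i%:R * coordv 1 x ^+ i.-1 * coordv 1 v))).

Lemma is_diff_xi_poly k x : is_diff x (xi_poly k) (dxi_poly k x).
Proof.
have dX j : is_diff x (coordv j) (coordv j) by exact: is_diff_coord.
have cM (c : K) (f df : 'rV[K]_n.+1 -> K) :
    is_diff x f df -> is_diff x (cst c * f) (c \*o df).
  move=> fdf; apply: (is_diff_eq (is_diffM (is_diff_cst c x) fdf)).
  by apply/funext => v; rewrite !fctE scaler0 addr0.
have -> : xi_poly k = cst (sgn_fact k.+1) * (coordv 2 ^+ k.+1) +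
    \sum_(i < k.+1) cst (sgn_fact (k - i)) *
      (coordv 1 ^+ i * coordv 2 ^+ (k - i) * coordv i.+2).
  apply/funext => y; rewrite /xi_poly /= !fctE; congr (_ + _).
  by rewrite fct_sumE; apply: eq_bigr => i _; rewrite !fctE.
have dM i := cM (sgn_fact (k - i)) _ _ (is_diffM (is_diffM
  (is_diff_exp i (dX 1%N)) (is_diff_exp (k - i) (dX 2%N))) (dX i.+2)).
apply: (is_diff_eq (is_diffD (cM (sgn_fact k.+1) _ _ (is_diff_exp k.+1 (dX 2%N)))
  (is_diff_sum (fun i : 'I_k.+1 => dM i)))).
apply/funext => v; rewrite /dxi_poly !fctE; congr (_ + _).
by rewrite fct_sumE; apply: eq_bigr => i _; rewrite !fctE.
Qed.

Lemma dxi_poly0 k x v :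
  (forall j, (1 <= j <= k.+2)%N -> coordv j v = 0) -> dxi_poly k x v = 0.
Proof.
move=> v0; rewrite /dxi_poly !v0 // !mulr0 add0r big1 // => i _.
by rewrite v0 ?ltnS ?leq_ord // !(mulr0, addr0).
Qed.

(* With [s i] the [i]-th term of the sum in [xi_poly], [x_(i.+2)] being     *)
(* replaced by [c * x_(i.+1)], the derivative of that sum telescopes.       *)
Lemma dxi_poly_shift k x v (c : K) : coordv 1 v = 0 ->
  (forall j, (1 <= j <= k.+1)%N -> coordv j.+1 v = c * coordv j x) ->
  dxi_poly k x v = 0.
Proof.
move=> v1 vS; rewrite /dxi_poly v1 (vS 1%N) //.
(* The cutoff makes the upper boundary term [s k.+1] vanish; the lower one, [s 0], cancels the
   leading term of [dxi_poly] by [sgn_factS]. *)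
pose s i := if (i <= k)%N then sgn_fact (k - i) *
   (coordv 1 x ^+ i * coordv 2 x ^+ (k - i) * (c * coordv i.+1 x)) else 0.
rewrite [X in _ + X](_ : _ = \sum_(0 <= i < k.+1) - (s i.+1 - s i)); last first.
  rewrite big_mkord; apply: eq_bigr => i _.
  rewrite vS ?ltnS ?leq_ord // /s leq_ord.
  case: ltnP => [ik|ki]; last first.
    have -> : (i : nat) = k by apply/eqP; rewrite eqn_leq ki -ltnS ltn_ord.
    by rewrite subnn; ring.
  have -> : (k - i = (k - i.+1).+1)%N by rewrite subnSK.
  rewrite /= !exprS; move: (sgn_factS (k - i.+1)).
  set m := (k - i.+1)%N => sm.
  have -> : sgn_fact m = - (sgn_fact m.+1 * m.+1%:R) by rewrite sm opprK.
  by ring.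
rewrite sumrN telescope_sumr // /s ltnn leq0n sub0r opprK subn0 expr0 mul1r.
by rewrite !mulrA sgn_factS !mulNr addNr.
Qed.

(** Euler's identity with weights: if [x_j] has weight [g - (j - 1) a], each monomial
    [x_1^i x_2^(k-i) x_(i+2)] and [x_2^(k+1)] have weight [(k + 1) (g - a)]. *)
Lemma dxi_poly_scale k x v (c a g : K) :
  (forall j, (1 <= j <= k.+2)%N ->
    coordv j v = c * ((g - j.-1%:R * a) * coordv j x)) ->
  dxi_poly k x v = c * (k.+1%:R * (g - a)) * xi_poly k x.
Proof.
have mulXn (y : K) m : m%:R * y ^+ m.-1 * y = m%:R * y ^+ m.
  by case: m => [|m]; rewrite ?mul0r //= -mulrA -exprSr.
move=> vE; rewrite /dxi_poly /xi_poly mulrDr; congr (_ + _).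
  rewrite vE // exprS /=; ring.
rewrite mulr_sumr; apply: eq_bigr => i _.
have ik : (i <= k)%N by rewrite -ltnS ltn_ord.
rewrite !vE ?ltnS ?leq_ord //=.
have -> : coordv 1 x ^+ i * ((k - i)%:R * coordv 2 x ^+ (k - i).-1 *
    (c * ((g - 1%:R * a) * coordv 2 x))) =
    coordv 1 x ^+ i * (c * (g - a) * ((k - i)%:R * coordv 2 x ^+ (k - i))).
  by rewrite -mulXn; ring.
have -> : i%:R * coordv 1 x ^+ i.-1 * (c * ((g - 0%:R * a) * coordv 1 x)) =
    c * g * (i%:R * coordv 1 x ^+ i).
  by rewrite -mulXn; ring.
rewrite natrB // -!natr1; ring.
Qed.

End XiPolynomial.

Lemma xiE (R : realType) (n k : nat) (x : 'rV[Cx R]_n.+1) :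
  xcoord 1 x != 0 -> xi k.+2 x = @xi_poly (Cx R) n k x.
Proof.
move=> x1; rewrite /xi /= big_ltn // /xi_poly; congr (_ + _).
  rewrite subSS subn0 /sgn_fact; congr (_ * _).
  rewrite [xcoord 1 x ^ _](_ : _ = (xcoord 1 x)^-1); last first.
    by rewrite -exprN1 //; congr (_ ^ _).
  by field.
rewrite (big_addn 0 _ 2) !subSS subn0 big_mkord; apply: eq_bigr => i _.
rewrite addn2 !subSS; congr (_ * (_ * _ * _)).
by rewrite -addn2 PoszD addrK.
Qed.

(** * The coadjoint matrix *)

(** A matrix supported on two rows and two columns is a sum of four matrices of rank at most 1. *)
Lemma mxrank_cross (F : fieldType) (m : nat) (M : 'M[F]_m) (a b : 'I_m) :
  (forall i j, i != a -> i != b -> j != a -> j != b -> M i j = 0) ->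
  (\rank M <= 4)%N.
Proof.
move=> M0.
have rank1 (c : 'cV[F]_m) (r : 'rV[F]_m) : (\rank (c *m r) <= 1)%N.
  exact: leq_trans (mxrankM_maxr _ _) (rank_leq_row _).
pose c t := \col_i M i t.
(* The entries in columns [a] and [b] are already accounted for by [c]. *)
pose r t := \row_j (if (j == a) || (j == b) then 0 else M t j).
have [ab|ab] := eqVneq a b.
  have -> : M = c a *m delta_mx 0 a + delta_mx a 0 *m r a.
    apply/matrixP => i j; rewrite !mxE !big_ord1 !mxE /= ab !eqxx orbb !andbT.
    have [->|jb] := eqVneq j b; first by rewrite mulr1 mulr0 addr0.
    rewrite mulr0 add0r; have [->|ib] := eqVneq i b; first by rewrite mul1r.
    by rewrite mul0r M0 ?ab.
  apply: leq_trans (mxrank_add _ _) _; rewrite -[4%N]/(2 + 2)%N.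
  by apply: leq_add; apply: leq_trans (rank1 _ _) _.
have -> : M = (c a *m delta_mx 0 a + c b *m delta_mx 0 b) +
    (delta_mx a 0 *m r a + delta_mx b 0 *m r b).
  apply/matrixP => i j; rewrite !mxE !big_ord1 !mxE /= !eqxx !andbT.
  have [->|ja] := eqVneq j a; first by rewrite (negbTE ab) /= !mulr0 mulr1 !addr0.
  have [->|jb] := eqVneq j b; first by rewrite /= !mulr0 mulr1 !addr0 add0r.
  rewrite /= !mulr0 !add0r.
  have [->|ia] := eqVneq i a; first by rewrite (negbTE ab) mul1r mul0r addr0.
  have [->|ib] := eqVneq i b; first by rewrite mul1r mul0r add0r.
  by rewrite !mul0r addr0 M0.
apply: leq_trans (mxrank_add _ _) _.
rewrite -[4%N]/(2 + 2)%N; apply: leq_add; apply: leq_trans (mxrank_add _ _) _;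
  exact: (@leq_add _ _ 1 1).
Qed.

Section CoadjointMatrix.
Variables (R : realType) (g : lieAlgType (Cx R)).
Implicit Types (u w : g).

Lemma lieC u w : lie w u = - lie u w.
Proof.
have lieDl a b c : lie (a + b) c = lie a c + lie b c :> g.
  by rewrite -[a]scale1r lie_linearl !scale1r.
have lieDr a b c : lie c (a + b) = lie c a + lie c b :> g.
  by rewrite -[a]scale1r lie_linearr !scale1r.
have := lie_alt (u + w); rewrite lieDl !lieDr !lie_alt add0r addr0 => /eqP.
by rewrite addrC addr_eq0 => /eqP.
Qed.

Variables (n : nat) (e : n.+1.-tuple g).
Implicit Types (x : 'rV[Cx R]_n.+1).

(** The point [x] of the dual as a linear form on [g], so that the bracket relations can be
    substituted without expanding structure constants. *)
Definition pairing x u : Cx R := \sum_k coord e k u * x 0 k.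

Lemma coadj_mxE x i j : coadj_mx e x i j = pairing x (lie e`_i e`_j).
Proof. by rewrite mxE. Qed.

Lemma pairingZ x c u : pairing x (c *: u) = c * pairing x u.
Proof.
by rewrite /pairing mulr_sumr; apply: eq_bigr => k _; rewrite linearZ -mulrA.
Qed.

Lemma pairing0 x : pairing x 0 = 0.
Proof. by rewrite -(scale0r 0) pairingZ mul0r. Qed.

Lemma pairingN x u : pairing x (- u) = - pairing x u.
Proof. by rewrite -scaleN1r pairingZ mulN1r. Qed.

Variables (alpha beta : Cx R).

Lemma gamE k : (0 < k < n)%N ->
  gam n alpha beta k = gam n alpha beta 1 - k.-1%:R * alpha.
Proof.
move=> /andP[k0 kn]; rewrite /gam.
have -> : (n - 1 - 1 = (n - k - 1) + k.-1)%N by lia.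
by rewrite natrD; ring.
Qed.

Hypothesis n4 : (4 <= n)%N.
Hypothesis He : commutation_relations alpha beta e.

(** Ordinals count from 0: those below [n.-1] index the abelian ideal spanned by
    [e_1, ..., e_(n-1)], while [n.-1] and [n] index [e_n] and [e_(n+1)]. *)
Lemma coadj_mx_nil x (i j : 'I_n.+1) : (i < n.-1)%N -> (j < n.-1)%N ->
  coadj_mx e x i j = 0.
Proof.
move=> ik jk; have [Hab _ _ _ _] := He; rewrite coadj_mxE.
have := Hab i.+1 j.+1; rewrite /= subn1 => ->; rewrite ?pairing0 //.
Qed.

Lemma coadj_row_abelian x (i : 'I_n.+1) k : (i < n.-1)%N -> (0 < k < n)%N ->
  xcoord k (row i (coadj_mx e x)) = 0.
Proof.
move=> ik /andP[k0 kn]; rewrite /xcoord mxE coadj_mx_nil // inordK; first by lia.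
by lia.
Qed.

Lemma coadj_row_shift1 x : xcoord 1 (row (inord n.-1) (coadj_mx e x)) = 0.
Proof.
have [_ H1 _ _ _] := He; rewrite /xcoord mxE coadj_mxE !inordK /=; [|lia|lia].
by rewrite lieC H1 oppr0 pairing0.
Qed.

Lemma rank_coadj_le4 x : (\rank (coadj_mx e x) <= 4)%N.
Proof.
have lt_n1 (i : 'I_n.+1) : i != inord n.-1 -> i != inord n -> (i < n.-1)%N.
  move=> /eqP i1 /eqP i2; have := ltn_ord i; rewrite ltnS => i3.
  have : (i : nat) != n.-1.
    by apply/eqP => E; apply: i1; apply/val_inj; rewrite /= inordK //; lia.
  have : (i : nat) != n.
    by apply/eqP => E; apply: i2; apply/val_inj; rewrite /= inordK.
  by lia.
apply: (@mxrank_cross _ _ _ (inord n.-1) (inord n)) => i j i1 i2 j1 j2.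
by rewrite coadj_mx_nil ?lt_n1.
Qed.

Hypothesis e_basis : basis_of {:g} e.

Lemma pairing_basis x k : (0 < k <= n.+1)%N -> pairing x e`_k.-1 = xcoord k x.
Proof.
move=> /andP[k0 kn]; have k1n : (k.-1 < n.+1)%N by rewrite prednK.
have ek (i : 'I_n.+1) : coord e i e`_k.-1 = (inord k.-1 == i)%:R.
  by rewrite -[k.-1 in LHS](@inordK n) // coord_free // (basis_free e_basis).
rewrite /pairing (bigD1 (inord k.-1)) //= big1 => [|i ik].
  by rewrite ek eqxx mul1r addr0.
by rewrite ek eq_sym (negbTE ik) mul0r.
Qed.

(** The row of [e_n] is the first vector field up to sign; the sign comes from reversing
    [[e_(k+1), e_n] = e_k]. *)
Lemma coadj_row_shift x k : (0 < k < n.-1)%N ->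
  xcoord k.+1 (row (inord n.-1) (coadj_mx e x)) = -1 * xcoord k x.
Proof.
move=> /andP[k0 kn]; have [_ _ Hsh _ _] := He.
rewrite /xcoord mxE coadj_mxE !inordK /=; [|lia|lia].
rewrite lieC pairingN mulN1r; congr (- _).
have := Hsh k.+1; rewrite /= => ->; last by lia.
by rewrite pairing_basis //; lia.
Qed.

Lemma coadj_row_scale x k : (0 < k < n)%N ->
  xcoord k (row (inord n) (coadj_mx e x)) =
  -1 * ((gam n alpha beta 1 - k.-1%:R * alpha) * xcoord k x).
Proof.
move=> kn; have [_ _ _ Hsc _] := He; rewrite -gamE //.
rewrite /xcoord mxE coadj_mxE !inordK /=; [|lia|lia].
rewrite lieC pairingN mulN1r; congr (- _).
have := Hsc k; rewrite /= => ->; last by lia.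
by rewrite pairingZ pairing_basis //; lia.
Qed.

Hypothesis gam1 : gam n alpha beta 1 != 0.

(* At [x = delta_mx ord0 ord0] the rows and columns of                      *)
(* [e_1, e_2, e_n, e_(n+1)] form, up to scaling and reordering, an identity *)
(* matrix.                                                                  *)
Lemma rank_coadj_delta :
  (4 <= \rank (coadj_mx e (delta_mx ord0 ord0 : 'rV[Cx R]_n.+1)))%N.
Proof.
have [Hab H1 Hsh Hsc Hn] := He.
set x := delta_mx ord0 ord0; set M := coadj_mx e x; set g1 := gam n alpha beta 1.
have xk k : (0 < k <= n.+1)%N -> pairing x e`_k.-1 = (k == 1%N)%:R.
  move=> kn; rewrite pairing_basis // /xcoord mxE eqxx /=; congr (_%:R).
  by rewrite -(inj_eq val_inj) /= inordK; lia.
(* Row [f_s] is matched with column [h_s]. The matched entries are [g1], 1, -1 and [- g1], and [c]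
   lists their inverses; [L] selects rows, [Q] selects and rescales columns. *)
pose f := [:: 0%N; 1%N; n.-1; n]; pose h := [:: n; n.-1; 1%N; 0%N].
pose c : seq (Cx R) := [:: g1^-1; 1; -1; - g1^-1].
pose L : 'M[Cx R]_(4, n.+1) := \matrix_(s, i) (i == inord (nth 0%N f s))%:R.
pose Q : 'M[Cx R]_(n.+1, 4) := 
  \matrix_(j, t) ((j == inord (nth 0%N h t))%:R * c`_t).
suff LMQ : L *m M *m Q = 1%:M.
  rewrite -(mxrank1 (Cx R) 4) -LMQ.
  exact: leq_trans (mxrankM_maxl _ _) (mxrankM_maxr _ _).
have entry s t :
    (L *m M *m Q) s t = M (inord (nth 0%N f s)) (inord (nth 0%N h t)) * c`_t.
  rewrite !mxE (bigD1 (inord (nth 0%N h t))) //= [X in _ + X]big1 ?addr0; last first.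
    by move=> j jt; rewrite !mxE (negbTE jt) mul0r mulr0.
  rewrite !mxE eqxx mul1r; congr (_ * _).
  rewrite (bigD1 (inord (nth 0%N f s))) //= [X in _ + X]big1 ?addr0; last first.
    by move=> j jt; rewrite !mxE (negbTE jt) mul0r.
  by rewrite mxE eqxx mul1r /M mxE.
have ME a b : (a <= n)%N -> (b <= n)%N ->
    M (inord a) (inord b) = pairing x (lie e`_a e`_b).
  by move=> an bn; rewrite /M coadj_mxE !inordK.
have M00 a b : (a < n.-1)%N -> (b < n.-1)%N -> pairing x (lie e`_a e`_b) = 0.
  move=> an bn; have := Hab a.+1 b.+1; rewrite /= => ->; try by lia.
  exact: pairing0.
have Ms a : (1 <= a < n.-1)%N -> pairing x (lie e`_a e`_n.-1) = (a == 1%N)%:R.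
  move=> an; have := Hsh a.+1; rewrite /= => ->; last by lia.
  by rewrite xk //; lia.
have M0n : pairing x (lie e`_0 e`_n.-1) = 0 by rewrite H1 pairing0.
have Mg a : (a < n.-1)%N -> pairing x (lie e`_a e`_n) = g1 * (a == 0%N)%:R.
  move=> an; have := Hsc a.+1; rewrite /= => ->; last by lia.
  rewrite pairingZ (xk a.+1) /=; last by lia.
  by case: a {an} => [|a]; rewrite ?mulr0 ?mulr1.
have Mnn : pairing x (lie e`_n.-1 e`_n) = 0.
  move: Hn; rewrite /= => ->; rewrite pairingZ xk; last by lia.
  by rewrite (_ : (n == 1)%N = false) ?mulr0 //; lia.
have MC a b : pairing x (lie e`_b e`_a) = - pairing x (lie e`_a e`_b).
  by rewrite lieC pairingN.
have n01 : (0 < n.-1)%N by lia. have n11 : (1 < n.-1)%N by lia.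
apply/matrixP => s t; rewrite entry [RHS]mxE.
case: s => [[|[|[|[|//]]]] ?]; case: t => [[|[|[|[|//]]]] ?];
  rewrite /= ME ?leq_pred //; try (by lia).
- by rewrite Mg // mulr1 mulfV.
- by rewrite M0n mul0r.
- by rewrite M00 // mul0r.
- by rewrite M00 // mul0r.
- by rewrite Mg // mulr0 mul0r.
- by rewrite Ms // mulr1.
- by rewrite M00 // mul0r.
- by rewrite M00 // mul0r.
- by rewrite Mnn mul0r.
- by rewrite lie_alt pairing0 mul0r.
- by rewrite MC Ms // mulrNN mulr1.
- by rewrite MC M0n oppr0 mul0r.
- by rewrite lie_alt pairing0 mul0r.
- by rewrite MC Mnn oppr0 mul0r.
- by rewrite MC Mg // mulr0 oppr0 mul0r.
- by rewrite MC Mg // mulr1 mulrNN mulfV.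
Qed.

Lemma num_invariantsE : num_invariants e = (n - 3)%N.
Proof.
rewrite /num_invariants; have -> : \dim {:g} = n.+1.
  by rewrite -(size_basis e_basis).
rewrite [X in (_ - X)%N](_ : _ = 4%N) ?subSS //; apply/eqP; rewrite eqn_leq.
apply/andP; split.
  apply/bigmax_leqP => r /asboolP[x <-]; exact: rank_coadj_le4.
have lt4 : (4 < n.+2)%N by lia.
apply: (leq_trans _ (leq_bigmax_cond (Ordinal lt4) _)) => //.
apply/asboolP; exists (delta_mx ord0 ord0); apply/eqP; rewrite eqn_leq.
by rewrite rank_coadj_le4 rank_coadj_delta.
Qed.

End CoadjointMatrix.

(** * Differential of the candidates and their affine slices *)

Section AbstractField.
Variables (K : numFieldType) (n : nat).
Implicit Types (x v y : 'rV[K]_n.+1) (k : nat).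

Lemma is_diff_mul_xi_poly (p H : 'rV[K]_n.+1 -> K) x k :
  {for x, continuous H} ->
  (\forall y \near x, p y = p x + (coordv 1 y - coordv 1 x) * H y) ->
  is_diff x (fun y => p y * xi_poly k y)
    (fun v => p x * dxi_poly k x v + xi_poly k x * (H x * coordv 1 v)).
Proof.
move=> cH pE; have [dX dXE] : is_diff x (@coordv K n 1) (coordv 1).
  exact: is_diff_coord.
(* The differential of [coordv 1] supplies the same function bundled as a linear map. *)
have dp : is_diff x p (H x \*: 'd (@coordv K n 1) x).
  apply: is_diff_caratheodory => //; first exact: diff_continuous.
  by apply: filterS pE => y ->; rewrite dXE /coordv !mxE.
apply: (is_diff_eq (is_diffM dp (is_diff_xi_poly k x))).
by apply/funext => v; rewrite !fctE dXE.
Qed.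

(** Once [x_1] and [x_2] are frozen, every remaining monomial is of degree at most 1. *)
Lemma xi_polyD k x v : coordv 1 v = 0 -> coordv 2 v = 0 ->
  xi_poly k (x + v) = xi_poly k x + \sum_(i < k.+1) sgn_fact K (k - i) *
    (coordv 1 x ^+ i * coordv 2 x ^+ (k - i) * coordv i.+2 v).
Proof.
move=> v1 v2; have cD j : coordv j (x + v) = coordv j x + coordv j v.
  by rewrite /coordv mxE.
rewrite /xi_poly !cD v1 v2 !addr0 -addrA -big_split /=; congr (_ + _).
by apply: eq_bigr => i _; rewrite cD !mulrDr.
Qed.

Lemma continuous_affine_mx m (M : 'M[K]_(m, n)) (a : 'rV[K]_n) (b : 'rV[K]_m) :
  continuous (fun y : 'rV[K]_m => a + (y - b) *m M).
Proof.
move=> y B [P nP sP].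
have : \forall z \near y, forall ij : 'I_1 * 'I_n,
    P ij.1 ij.2 ((a + (z - b) *m M) ij.1 ij.2).
  apply: (@filter_forall _ _ (fun (ij : 'I_1 * 'I_n) z =>
    P ij.1 ij.2 ((a + (z - b) *m M) ij.1 ij.2)) _ (nbhs_filter y)) => -[i j] /=.
  have c : {for y, continuous (fun z : 'rV[K]_m => (a + (z - b) *m M) i j)}.
    have -> : (fun z : 'rV[K]_m => (a + (z - b) *m M) i j) =
        (fun z => a i j + \sum_k ((z i k - b i k) * M k j)).
      apply/funext => z; rewrite !mxE; congr (_ + _).
      by apply: eq_bigr => k _; rewrite !mxE.
    apply: continuousD; first exact: cst_continuous.
    suff: continuous (fun z : 'rV[K]_m => \sum_k (z i k - b i k) * M k j) by exact.
    apply: continuous_big => [|k _ z]; first exact: add_continuous.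
    apply: (@continuousM _ _ (fun z : 'rV[K]_m => z i k - b i k) (cst (M k j)));
      last exact: cst_continuous.
    apply: (@continuousB _ _ _ (fun z : 'rV[K]_m => z i k) (cst (b i k)));
      [exact: coord_continuous|exact: cst_continuous].
  exact/c/nP.
by apply: filterS => z Pz; apply: sP => i j; exact: (Pz (i, j)).
Qed.

End AbstractField.

(** * Functional independence *)

Section Independence.
Variables (R : realType) (n : nat) (U : set 'rV[Cx R]_n.+1).

Lemma power_branch_neq0 a p x :
  power_branch U (@xi R n 1) a p -> U x -> xcoord 1 x != 0.
Proof.
by move=> [l lU] /lU[_ lx _]; move: lx; rewrite /xi /= => <-; exact: cexp_neq0.
Qed.

Hypothesis n4 : (4 <= n)%N.

Lemma functionally_independent_power_branch
    (p : 'I_(n - 3) -> 'rV[Cx R]_n.+1 -> Cx R) (b : 'I_(n - 3) -> Cx R) :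
  (forall i, power_branch U (@xi R n 1) (b i) (p i)) ->
  functionally_independent U (fun (i : 'I_(n - 3)) x => p i x * xi (i + 3) x).
Proof.
move=> branch V oV [x0 Vx0] VU [W [Phi [oW _ FW PhiN0]]].
have [l lU] := choice branch.
pose F (i : 'I_(n - 3)) x := p i x * xi (i + 3) x.
pose y0 := \row_i F i x0.
have Ux0 := VU _ Vx0.
have i0 : 'I_(n - 3) by apply: (@Ordinal _ 0); lia.
have x10 : coordv 1 x0 != 0 := power_branch_neq0 (branch i0) Ux0.
(* The linear part of the candidates in [x_3, ..., x_(n-1)] along the slice through [x0]. It is
   triangular with diagonal entries [p i x0 * x_1^(i+1)], all nonzero. *)
pose B : 'M[Cx R]_(n - 3) := \matrix_(i, j) if (j <= i)%N then
  p i x0 * (sgn_fact (Cx R) (i - j) *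
    (coordv 1 x0 ^+ j.+1 * coordv 2 x0 ^+ (i - j))) else 0.
have uB : B^T \in unitmx.
  rewrite unitmx_tr unitmxE det_trig; last first.
    by apply/is_trig_mxP => i j ij; rewrite mxE leqNgt ij.
  rewrite unitfE; apply/prodf_neq0 => i _.
  rewrite mxE leqnn subnn /sgn_fact expr0 fact0 divr1 !mul1r expr0 mulr1.
  have [_ _ ->] := lU i _ Ux0.
  by rewrite mulf_neq0 ?cexp_neq0 // expf_neq0.
(* [E] puts the [j]-th parameter in the coordinate [x_(j+3)], and [G] is a local right inverse of
   the candidates through [x0]. *)
pose E : 'M[Cx R]_(n - 3, n.+1) := \matrix_(j, t) (t == j.+2 :> nat)%:R.
pose G (y : 'rV[Cx R]_(n - 3)) := x0 + (y - y0) *m (invmx B^T *m E).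
have cG : {for y0, continuous G} by exact: continuous_affine_mx.
have Gy0 : G y0 = x0 by rewrite /G subrr mul0mx addr0.
have nV : \forall y \near y0, V (G y).
  have VG0 : nbhs (G y0) V by rewrite Gy0; exact: open_nbhs_nbhs.
  exact: cG VG0.
(* Since [x_1] is constant along [G], this makes each [l i], and hence each [p i], constant
   there. *)
have nl : \forall y \near y0,
    forall i, cexp (l i (G y)) = cexp (l i x0) -> l i (G y) = l i x0.
  apply: (@filter_forall _ _ (fun i y =>
    cexp (l i (G y)) = cexp (l i x0) -> l i (G y) = l i x0) _ (nbhs_filter y0)) => i.
  have [cl _ _] := lU i _ Ux0.
  have lG0 : \forall z \near G y0, cexp (l i z) = cexp (l i x0) -> l i z = l i x0.
    by rewrite Gy0; exact: log_branch_inj.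
  exact: cG lG0.
have near0 : \forall y \near y0, W y /\ Phi y = 0.
  apply: filterS2 nV nl => y VG lG; have UG := VU _ VG.
  suff <- : \row_i F i (G y) = y by exact: FW.
  apply/rowP => i; rewrite mxE.
  pose w := (y - y0) *m invmx B^T; pose v := w *m E.
  have GE : G y = x0 + v by rewrite /G mulmxA.
  have vE t : (t <= n)%N -> coordv t.+1 v = \sum_j w 0 j * (t == j.+2)%:R.
    move=> tn; rewrite /coordv mxE; apply: eq_bigr => j _; congr (_ * _).
    by rewrite mxE inordK.
  have v1 : coordv 1 v = 0 by rewrite vE // big1 // => j _; rewrite mulr0.
  have v2 : coordv 2 v = 0.
    by rewrite vE ?big1 // => [j _|]; [rewrite mulr0|lia].
  have v3 (j : 'I_(n - 3)) : coordv j.+3 v = w 0 j.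
    rewrite vE; last by have := ltn_ord j; lia.
    rewrite (bigD1 j) //= big1 ?eqxx ?mulr1 ?addr0 // => j' j'j.
    by rewrite !eqSS eq_sym (negbTE (_ : (j' : nat) != j)) ?mulr0.
  have G1 : coordv 1 (G y) = coordv 1 x0.
    by rewrite GE -[RHS]addr0 -v1 /coordv mxE.
  have pG : p i (G y) = p i x0.
    have [_ lx ->] := lU i _ Ux0; have [_ lGy ->] := lU i _ UG.
    by rewrite (lG i) // lx lGy; exact: G1.
  have G10 : coordv 1 (G y) != 0 by rewrite G1.
  rewrite /F pG addn3 xiE; last exact: G10.
  rewrite GE xi_polyD // mulrDr.
  have -> : p i x0 * xi_poly i.+1 x0 = y0 0 i.
    by rewrite mxE /F addn3 xiE //; exact: x10.
  have -> : p i x0 * (\sum_(j < i.+2) sgn_fact (Cx R) (i.+1 - j) *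
      (coordv 1 x0 ^+ j * coordv 2 x0 ^+ (i.+1 - j) * coordv j.+2 v)) =
      (w *m B^T) 0 i.
    (* The term of index 0 involves the zero coordinate [x_2] of [v]; the others, shifted by one,
       are row [i] of [B] padded with zeros. *)
    rewrite big_ord_recl v2 !mulr0 add0r mxE mulr_sumr.
    rewrite (big_ord_widen (n - 3) (fun j => p i x0 *
      (sgn_fact (Cx R) (i.+1 - j.+1) * (coordv 1 x0 ^+ j.+1 *
       coordv 2 x0 ^+ (i.+1 - j.+1) * coordv j.+3 v)))) //.
    rewrite big_mkcond; apply: eq_bigr => j _.
    rewrite [B^T j i]mxE [B i j]mxE ltnS v3 subSS.
    by case: ifP => _; [ring|rewrite mulr0].
  by rewrite mulmxKV // !mxE subrKC.
(* [Phi] vanishes on a neighbourhood of [y0], so its zero set has nonempty interior. *)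
have [||y yI /eqP] := PhiN0 _ (open_interior [set y | W y /\ Phi y = 0]).
- by exists y0.
- by move=> y /interior_subset[].
by apply; have [] := interior_subset yI.
Qed.

End Independence.

(** * Invariance *)

Section Invariance.
Variables (R : realType) (n : nat) (alpha beta : Cx R).
Variables (g : lieAlgType (Cx R)) (e : n.+1.-tuple g).
Hypothesis n4 : (4 <= n)%N.
Hypothesis gam1 : gam n alpha beta 1 != 0.
Hypothesis e_basis : basis_of {:g} e.
Hypothesis He : commutation_relations alpha beta e.

(** The weight of the power of [x_1] is opposite to that of [xi k.+2], as
    [gamma_2 = gamma_1 - alpha]. *)
Lemma xi_exponentE k :
  xi_exponent n alpha beta k.+2 * gam n alpha beta 1 =
  - (k.+1%:R * (gam n alpha beta 1 - alpha)).
Proof.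
have gE : gam n alpha beta 1 = (n - 2)%:R * alpha + beta.
  by rewrite /gam -subnDA.
rewrite /xi_exponent -gE subSS subn0.
have -> : (n - 3)%:R * alpha + beta = gam n alpha beta 1 - alpha.
  by rewrite gE (_ : (n - 2 = (n - 3).+1)%N) -?natr1; [ring|lia].
by field.
Qed.

(** Here [c] is the derivative of the power branch with respect to [x_1]. Rows of the ideal do not
    touch [x_1, ..., x_(n-1)]; the row of [e_n] is handled by telescoping, that of [e_(n+1)] by
    weights. *)
Lemma coadj_invariance x (i : 'I_n.+1) k (p c : Cx R) :
  (k.+2 < n)%N -> coordv 1 x != 0 ->
  c = xi_exponent n alpha beta k.+2 * p / coordv 1 x ->
  let v := row i (coadj_mx e x) in
  p * dxi_poly k x v + xi_poly k x * (c * coordv 1 v) = 0.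
Proof.
move=> kn x1 -> v; have [ik|ik] := ltnP i n.-1.
  have v0 j : (1 <= j <= k.+2)%N -> coordv j v = 0.
    by move=> jk; apply: (coadj_row_abelian n4 He) => //; lia.
  by rewrite dxi_poly0 // v0 // !mulr0 addr0.
have [iE|iE] : (i : nat) = n.-1 \/ (i : nat) = n.
- by have := ltn_ord i; lia.
- have vi : v = row (inord n.-1) (coadj_mx e x).
    by rewrite /v; congr (row _ _); apply/val_inj; rewrite /= inordK //; lia.
  have v1 : coordv 1 v = 0 by rewrite vi; exact: (coadj_row_shift1 n4 He).
  rewrite v1 !mulr0 addr0 (@dxi_poly_shift _ _ _ _ _ (-1)) ?mulr0 // => j jk.
  by rewrite vi; apply: (coadj_row_shift n4 He e_basis); lia.
have vi : v = row (inord n) (coadj_mx e x).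
  by rewrite /v; congr (row _ _); apply/val_inj; rewrite /= inordK.
have vE j : (1 <= j <= k.+2)%N -> coordv j v =
    -1 * ((gam n alpha beta 1 - j.-1%:R * alpha) * coordv j x).
  by move=> jk; rewrite vi; apply: (coadj_row_scale n4 He e_basis); lia.
rewrite (dxi_poly_scale vE) vE //=.
have := xi_exponentE k; set a := xi_exponent _ _ _ _ => aE.
have -> : a * p / coordv 1 x *
    (-1 * ((gam n alpha beta 1 - 0%:R * alpha) * coordv 1 x)) =
    - p * (a * gam n alpha beta 1) by field.
by rewrite aE; ring.
Qed.

Variables (U : set 'rV[Cx R]_n.+1).
Hypothesis oU : open U.

Lemma invariant_on_power_branch k p : (k.+2 < n)%N ->
  power_branch U (@xi R n 1) (xi_exponent n alpha beta k.+2) p ->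
  invariant_on e U (fun x => p x * xi k.+2 x).
Proof.
move=> kn branch; have [l lU] := branch.
pose a := xi_exponent n alpha beta k.+2.
have dF x : U x -> is_diff x (fun x => p x * xi k.+2 x)
    (fun v => p x * dxi_poly k x v +
       xi_poly k x * (a * p x / coordv 1 x * coordv 1 v)).
  move=> Ux; have nU : nbhs x U by exact: open_nbhs_nbhs.
  have [cl _ _] := lU _ Ux.
  have near_x : \forall y \near x,
      cexp (l y) = coordv 1 y /\ p y = cexp (a * l y).
    by apply: filterS nU => y Uy; have [] := lU _ Uy.
  have [H [cH Hx pE]] := power_branch_increment cl near_x.
  (* [xi] agrees with the polynomial only where [x_1] is nonzero, which holds on the open set
     [U]. *)
  apply: (@is_diff_near _ _ _ _ (fun y => p y * xi_poly k y)).
    by apply: filterS nU => y Uy; rewrite xiE // (power_branch_neq0 branch).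
  by rewrite -Hx; exact: is_diff_mul_xi_poly.
split=> [x Ux|x Ux i]; first by have [] := dF x Ux.
have [dFx dFE] := dF x Ux.
have := @coadj_invariance x i k (p x) _ kn (power_branch_neq0 branch Ux) erefl.
rewrite /= => inv; rewrite -[RHS]inv.
have /(congr1 (fun f => f (row i (coadj_mx e x)))) /= <- := dFE.
(* By linearity, the sum of partial derivatives is the differential applied to row [i]. *)
rewrite [in RHS](row_sum_delta (row i (coadj_mx e x))) linear_sum.
by apply: eq_bigr => j _; rewrite linearZ /= deriveE // !mxE.
Qed.

End Invariance.

Theorem mainTheorem6 (R : realType) (n : nat) (alpha beta : Cx R)
    (g : lieAlgType (Cx R)) (e : n.+1.-tuple g)
    (U : set 'rV[Cx R]_n.+1) (p : 'I_(n - 3) -> 'rV[Cx R]_n.+1 -> Cx R) :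
  (4 <= n)%N ->
  (alpha = 0 /\ beta = 1) \/ alpha = 1 ->
  (alpha, beta) <> (1, 2%:R - n%:R) ->
  basis_of {:g} e ->
  commutation_relations alpha beta e ->
  domain_set U ->
  (forall i : 'I_(n - 3),
     power_branch U (@xi R n 1) (xi_exponent n alpha beta (i + 3)) (p i)) ->
  invariant_basis e U (fun (i : 'I_(n - 3)) x => p i x * xi (i + 3) x).
Proof.
move=> n4 ab abN e_basis He [oU _ _] branch.
(* For [alpha = 1] one has [gamma_1 = n - 2 + beta], which vanishes exactly at the excluded pair. *)
have gam1 : gam n alpha beta 1 != 0.
  rewrite /gam -subnDA; case: ab => [[-> ->]|a1].
    by rewrite mulr0 add0r oner_neq0.
  apply/eqP; rewrite a1 mulr1 natrB => [gam0|]; last by lia.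
  by apply: abN; rewrite a1; congr (_, _); rewrite -[LHS]subr0 -gam0; ring.
split.
- move=> i; have := branch i; rewrite addn3.
  by apply: invariant_on_power_branch => //; have := ltn_ord i; lia.
- exact: functionally_independent_power_branch branch.
- by rewrite (num_invariantsE n4 He e_basis gam1).
Qed.
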